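(* Let $\zeta,\varsigma,\tau,\delta\in\mathbb{T}$ be bicomplex numbers, $\zeta=z_1+i_2z_2=\zeta_1e_1+\zeta_2e_2$, $\varsigma=\varsigma_1e_1+\varsigma_2e_2$, $\tau=\tau_1e_1+\tau_2e_2$, with $|\operatorname{Im}_j(\varsigma)|<\operatorname{Re}(\varsigma)$ and $|\operatorname{Im}_j(\tau)|<\operatorname{Re}(\tau)$. Then the bicomplex Prabhakar function satisfies $$\mathbb{E}_{\varsigma,\tau}^{\delta}(\zeta)=\sum_{k=0}^{\infty}\frac{(\delta)_k}{k!\,\Gamma(\varsigma k+\tau)}\,\zeta^k.$$
   Context: $\mathbb{T}=\{x_0+i_1x_1+i_2x_2+jx_3: x_0,\dots,x_3\in\mathbb{R}\}$ is the commutative algebra of bicomplex numbers, with $i_1^2=i_2^2=-1$, $j=i_1i_2=i_2i_1$, $j^2=1$; write $\operatorname{Re}=x_0$, $\operatorname{Im}_j=x_3$. $\mathbb{C}$ is identified with $\{x_0+i_1x_1\}$. With $e_1=\frac{1+i_1i_2}{2}$, $e_2=\frac{1-i_1i_2}{2}$ (so $e_1e_2=0$, $e_1+e_2=1$, $e_r^2=e_r$), every $\xi=w_1+i_2w_2$ ($w_1,w_2\in\mathbb{C}$) is uniquely $\xi=\xi_1e_1+\xi_2e_2$ with $\xi_1=w_1-i_1w_2$, $\xi_2=w_1+i_1w_2\in\mathbb{C}$; addition, multiplication and limits are componentwise in this representation. The bicomplex Gamma function is $\Gamma(\xi)=\Gamma(\xi_1)e_1+\Gamma(\xi_2)e_2$,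 and $(\delta)_k=\delta(\delta+1)\cdots(\delta+k-1)$, $(\delta)_0=1$. The symbol $\mathbb{E}_{\varsigma,\tau}^{\delta}(\zeta)$ denotes the bicomplex Prabhakar function (bicomplex three-parameter Mittag-Leffler function), which is introduced as the function defined by this same series under the same conditions on $\varsigma$ and $\tau$; the result is offered in support of that definition. *)

(* Defs.v *)
From HB Require Import structures.
From mathcomp Require Import all_boot all_order all_algebra.
From mathcomp Require Import all_classical all_reals all_analysis.
From mathcomp Require Import complex.
From mathcomp Require Import ring.

Set Implicit Arguments.
Unset Strict Implicit.
Unset Printing Implicit Defensive.

Import Order.TTheory GRing.Theory Num.Theory.
Import numFieldNormedType.Exports.

Local Open Scope classical_set_scope.
Local Open Scope ring_scope.
Local Open Scope complex_scope.

(* R[i] gets the normed-space structure coming from its modulus. *)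
HB.instance Definition _ (R : realType) := NormedModule.copy R[i] (R[i])^o.

(* The pair (w1, w2) stands for w1 + i_2 w2, where R[i] is C(i_1). The name is
   an alias so that the product below replaces the componentwise product of
   pairs; addition and topology are those of R[i] * R[i], i.e. of R^4. *)
Definition bicomplex (R : realType) : Type := (R[i] * R[i])%type.

HB.instance Definition _ (R : realType) :=
  NormedModule.copy (bicomplex R) (R[i] * R[i])%type.

Section Algebra.
Variable R : realType.
Implicit Types u v w : bicomplex R.

Definition bc_one : bicomplex R := (1, 0).

Definition bc_mul u v : bicomplex R :=
  (u.1 * v.1 - u.2 * v.2, u.1 * v.2 + u.2 * v.1).

Lemma bc_mulA : associative bc_mul.
Proof. by move=> u v w; congr pair => /=; ring. Qed.

Lemma bc_mulC : commutative bc_mul.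
Proof. by move=> u v; congr pair => /=; ring. Qed.

Lemma bc_mul1 : left_id bc_one bc_mul.
Proof. by move=> [a b]; congr pair => /=; ring. Qed.

Lemma bc_mulDl : left_distributive bc_mul +%R.
Proof. by move=> u v w; congr pair => /=; ring. Qed.

Lemma bc_one_neq0 : bc_one != 0.
Proof. by apply/eqP => -[] /eqP; rewrite oner_eq0. Qed.

HB.instance Definition _ := GRing.Zmodule_isComNzRing.Build (bicomplex R)
  bc_mulA bc_mulC bc_mul1 bc_mulDl bc_one_neq0.

Lemma bc_mulE u v : u * v = (u.1 * v.1 - u.2 * v.2, u.1 * v.2 + u.2 * v.1).
Proof. by []. Qed.

(* Equal to the product of the two idempotent components of u. *)
Definition bc_cnorm u : R[i] := u.1 ^+ 2 + u.2 ^+ 2.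

Definition bc_unit : {pred bicomplex R} := fun u => bc_cnorm u != 0.

Definition bc_inv u : bicomplex R :=
  if bc_cnorm u != 0 then (u.1 / bc_cnorm u, - u.2 / bc_cnorm u) else u.

Lemma bc_mulVx : {in bc_unit, left_inverse 1 bc_inv *%R}.
Proof.
move=> u uU; have u0 : bc_cnorm u != 0 := uU.
rewrite /bc_inv u0 bc_mulE; congr pair => /=; last by ring.
by apply: (mulfI u0); rewrite mulr1 /bc_cnorm; field.
Qed.

Lemma bc_unitPl u v : v * u = 1 -> u \in bc_unit.
Proof.
rewrite bc_mulE => -[] e1 e2; apply/negP => /eqP u0.
have : bc_cnorm v * bc_cnorm u = 1.
  rewrite -[RHS](_ : 1 ^+ 2 + 0 ^+ 2 = 1); last by rewrite expr0n expr1n addr0.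
  by rewrite -[in RHS]e1 -[in RHS]e2 /bc_cnorm; ring.
by rewrite u0 mulr0 => /eqP; rewrite eq_sym oner_eq0.
Qed.

Lemma bc_inv_out : {in [predC bc_unit], bc_inv =1 id}.
Proof. by move=> u /negbTE uU; rewrite /bc_inv ifF. Qed.

HB.instance Definition _ := GRing.ComNzRing_hasMulInverse.Build (bicomplex R)
  bc_mulVx bc_unitPl bc_inv_out.

Definition bc_of (z : R[i]) : bicomplex R := (z, 0).
Definition bc_i1 : bicomplex R := bc_of 'i%C.
Definition bc_i2 : bicomplex R := (0, 1).
Definition bc_j : bicomplex R := bc_i1 * bc_i2.

Definition bc_e1 : bicomplex R := (1 + bc_j) / 2%:R.
Definition bc_e2 : bicomplex R := (1 - bc_j) / 2%:R.

Definition bc_fst u : R[i] := u.1 - 'i%C * u.2.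
Definition bc_snd u : R[i] := u.1 + 'i%C * u.2.

(* Real part x_0 and j-part x_3 of x_0 + i_1 x_1 + i_2 x_2 + j x_3. *)
Definition bc_Re u : R := complex.Re u.1.
Definition bc_Imj u : R := complex.Im u.2.

Lemma bc_coordE (x0 x1 x2 x3 : R) :
  bc_of x0%:C + bc_i1 * bc_of x1%:C + bc_i2 * bc_of x2%:C + bc_j * bc_of x3%:C
  = (x0 +i* x1, x2 +i* x3).
Proof.
rewrite /bc_j !bc_mulE /=; congr pair; rewrite /= ?mul0r ?mulr0 ?mul1r ?mulr1;
  by apply/eqP; rewrite eq_complex /=; apply/andP; split; apply/eqP => /=; ring.
Qed.

Lemma bc_natrE n : n%:R = (n%:R, 0) :> bicomplex R.
Proof.
by elim: n => [//|n IHn]; rewrite !mulrS IHn [LHS]surjective_pairing /= addr0.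
Qed.

Lemma bc_half u : u / 2%:R = (u.1 / 2%:R, u.2 / 2%:R).
Proof.
have n2 : (2%:R : R[i]) != 0 by rewrite pnatr_eq0.
have u2 : (2%:R : bicomplex R) \is a GRing.unit.
  rewrite bc_natrE; change (bc_cnorm (2%:R, 0) != 0).
  by rewrite /bc_cnorm /= [0 ^+ 2]expr0n addr0 expf_neq0.
apply: (mulIr u2); rewrite divrK // bc_natrE bc_mulE /= !mulr0 subr0 add0r.
by rewrite !divfK //; case: u.
Qed.

Lemma bc_idem_decomp u :
  u = bc_of (bc_fst u) * bc_e1 + bc_of (bc_snd u) * bc_e2.
Proof.
have n2 : (2%:R : R[i]) != 0 by rewrite pnatr_eq0.
have i2 : 'i%C * 'i%C = -1 :> R[i] by rewrite -expr2 sqr_i.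
rewrite /bc_e1 /bc_e2 !bc_half /bc_j /bc_i1 /bc_i2 /bc_fst /bc_snd.
case: u => a b; rewrite !bc_mulE /=; congr pair => /=.
  by field.
transitivity (- ('i%C * 'i%C) * b); first by rewrite i2 opprK mul1r.
by move: 'i%C {i2} => c; field.
Qed.

Lemma bc_cvgP (u : nat -> bicomplex R) (l : bicomplex R) :
  u @ \oo --> l <->
  (bc_fst \o u @ \oo --> bc_fst l) /\ (bc_snd \o u @ \oo --> bc_snd l).
Proof.
split=> [ul|[u1 u2]].
  have ul1 : (fun n => (u n).1) @ \oo --> l.1.
    by apply: (cvg_comp _ _ ul); exact: cvg_fst.
  have ul2 : (fun n => (u n).2) @ \oo --> l.2.
    by apply: (cvg_comp _ _ ul); exact: cvg_snd.
  have iul2 : (fun n => 'i%C * (u n).2) @ \oo --> 'i%C * l.2.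
    by apply: cvgM ul2; exact: cvg_cst.
  split; [exact: (cvgB ul1 iul2)|exact: (cvgD ul1 iul2)].
have v1 : (fun n => (bc_fst (u n) + bc_snd (u n)) * 2%:R^-1) @ \oo -->
    (bc_fst l + bc_snd l) * 2%:R^-1.
  by apply: cvgM (cvgD u1 u2) _; exact: cvg_cst.
have v2 : (fun n => (bc_snd (u n) - bc_fst (u n)) * (2%:R * 'i%C)^-1) @ \oo -->
    (bc_snd l - bc_fst l) * (2%:R * 'i%C)^-1.
  by apply: cvgM (cvgB u2 u1) _; exact: cvg_cst.
have E1 v : v.1 = (bc_fst v + bc_snd v) * 2%:R^-1.
  by rewrite /bc_fst /bc_snd; field.
have E2 v : v.2 = (bc_snd v - bc_fst v) * (2%:R * 'i%C)^-1.
  rewrite /bc_fst /bc_snd; field.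
  by apply/eqP => -[] /eqP; rewrite oner_eq0.
rewrite -E1 -(funext (fun n => E1 (u n))) in v1.
rewrite -E2 -(funext (fun n => E2 (u n))) in v2.
have -> : u = fun n => ((u n).1, (u n).2) by apply/funext => n; case: (u n).
by case: l v1 v2 {u1 u2} => l1 l2 v1 v2; exact: (cvg_pair v1 v2).
Qed.

End Algebra.

Section Prabhakar.
Variable R : realType.

Definition cexp (z : R[i]) : R[i] :=
  (expR (complex.Re z) * cos (complex.Im z))
  +i* (expR (complex.Re z) * sin (complex.Im z)).

(* Euler-Gauss definition of Gamma, meaningful on all of C minus the poles
   0, -1, -2, ...: the limit of n! n^z / (z (z + 1) ... (z + n)), with
   n^z = exp (z ln n). *)
Definition cGamma (z : R[i]) : R[i] :=
  lim ((fun n : nat => n`!%:R * cexp (z * (ln n%:R)%:C)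
         / \prod_(i < n.+1) (z + i%:R)) @ \oo).

Definition bc_Gamma (u : bicomplex R) : bicomplex R :=
  bc_of (cGamma (bc_fst u)) * bc_e1 R + bc_of (cGamma (bc_snd u)) * bc_e2 R.

Definition bc_poch (delta : bicomplex R) (k : nat) : bicomplex R :=
  \prod_(i < k) (delta + i%:R).

Definition prabhakar_term (vsigma tau delta zeta : bicomplex R) (k : nat) :
    bicomplex R :=
  bc_poch delta k / (k`!%:R * bc_Gamma (vsigma * k%:R + tau)) * zeta ^+ k.

(* Only meaningful when the series converges: lim is a choice operator. *)
Definition prabhakar (vsigma tau delta zeta : bicomplex R) : bicomplex R :=
  lim (series (prabhakar_term vsigma tau delta zeta) @ \oo).

End Prabhakar.

(* Main.v *)
(* Writing every bicomplex number in the idempotent basis e1, e2 turns the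
   series into two complex Prabhakar series, and the hypotheses on vsigma and
   tau say that both idempotent components of each lie in the right half-plane.
   There the quotient of two consecutive terms of Gauss' product for Gamma is
   1 + O(1/n^2), so the product converges. For a natural m >= |z|, the factors
   |z + N| of its denominator with 0 < N <= m contribute at most
   m! 'C(2m, m) <= m! 4^m, and the others are estimated by
   |z + N| <= N exp (Re z / N + |z|^2 / (2 N^2)); this gives
   |Gamma z| >= exp (Re z ln m - 5 m). Along z = s k + t with Re s, Re t > 0, and
   m affine in k, 1 / |Gamma z| is thus O(C^k k^(- Re s k)), while
   (delta)_k / k! * zeta^k grows at most geometrically. *)

Require Import Defs.
From HB Require Import structures.
From mathcomp Require Import all_boot all_order all_algebra.
From mathcomp Require Import all_classical all_reals all_analysis.
From mathcomp Require Import complex.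
From mathcomp Require Import ring lra.

Import Order.TTheory GRing.Theory Num.Theory.
Import numFieldNormedType.Exports.
Import ComplexField.Normc.

Local Open Scope classical_set_scope.
Local Open Scope ring_scope.

(** * Modulus, real and imaginary parts, and convergence criteria in [R[i]] *)

Section Modulus.
Context {R : realType}.
Implicit Types z w : R[i].

Lemma normc_norm z : `|z| = (normc z)%:C%C.
Proof. by case: z. Qed.

Lemma normc_ge0 z : 0 <= normc z.
Proof. by case: z => a b; rewrite sqrtr_ge0. Qed.

Lemma normc_real (x : R) : normc x%:C%C = `|x|.
Proof. by rewrite /= expr0n addr0 sqrtr_sqr. Qed.

Lemma normc_nat n : normc (n%:R : R[i]) = n%:R.
Proof. by rewrite -(rmorph_nat (real_complex R)) normc_real normr_nat. Qed.

Lemma normcX z n : normc (z ^+ n) = normc z ^+ n.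
Proof.
by elim: n => [|n IH]; rewrite ?expr0 ?normc1 // !exprS normcM IH.
Qed.

Lemma normc_prod (I : Type) (r : seq I) (P : pred I) (F : I -> R[i]) :
  normc (\prod_(i <- r | P i) F i) = \prod_(i <- r | P i) normc (F i).
Proof. by apply: (big_morph (@normc R)) => [z w|]; rewrite ?normcM ?normc1. Qed.

Lemma sqr_normcE z : normc z ^+ 2 = complex.Re z ^+ 2 + complex.Im z ^+ 2.
Proof. by case: z => a b; rewrite /= sqr_sqrtr // addr_ge0 ?sqr_ge0. Qed.

Lemma Re_le_normc z : `|complex.Re z| <= normc z.
Proof.
rewrite -(ler_sqr (normr_ge0 _) (normc_ge0 _)) sqr_normcE.
rewrite real_normK ?num_real //.
by rewrite lerDl sqr_ge0.
Qed.

Lemma Im_le_normc z : `|complex.Im z| <= normc z.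
Proof.
rewrite -(ler_sqr (normr_ge0 _) (normc_ge0 _)) sqr_normcE.
rewrite real_normK ?num_real //.
by rewrite lerDr sqr_ge0.
Qed.

Lemma normc_le_ReIm z : normc z <= `|complex.Re z| + `|complex.Im z|.
Proof.
rewrite -(ler_sqr (normc_ge0 _) (addr_ge0 (normr_ge0 _) (normr_ge0 _))).
rewrite sqr_normcE -[complex.Re z ^+ 2]real_normK ?num_real //.
rewrite -[complex.Im z ^+ 2]real_normK ?num_real //.
by have := normr_ge0 (complex.Re z); have := normr_ge0 (complex.Im z); nra.
Qed.

Lemma ReD z w : complex.Re (z + w) = complex.Re z + complex.Re w.
Proof. by case: z w => [a b] [c d]. Qed.

Lemma ImD z w : complex.Im (z + w) = complex.Im z + complex.Im w.
Proof. by case: z w => [a b] [c d]. Qed.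

Lemma ReB z w : complex.Re (z - w) = complex.Re z - complex.Re w.
Proof. by case: z w => [a b] [c d]. Qed.

Lemma ImB z w : complex.Im (z - w) = complex.Im z - complex.Im w.
Proof. by case: z w => [a b] [c d]. Qed.

Lemma Re_nat n : complex.Re (n%:R : R[i]) = n%:R.
Proof. by rewrite -(rmorph_nat (real_complex R)). Qed.

Lemma Im_nat n : complex.Im (n%:R : R[i]) = 0.
Proof. by rewrite -(rmorph_nat (real_complex R)). Qed.

Lemma ReM_nat z n : complex.Re (z * n%:R) = complex.Re z * n%:R.
Proof.
rewrite -(rmorph_nat (real_complex R)); case: z => a b /=.
by rewrite mulr0 subr0.
Qed.

Lemma cvgc_ReIm (u : nat -> R[i]) (a b : R) :
  (@complex.Re R \o u) @ \oo --> a -> (@complex.Im R \o u) @ \oo --> b ->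
  u @ \oo --> (a +i* b)%C.
Proof.
move=> ua ub; apply/cvgrPdist_lt => -[e e'] /=.
(* In the partial order of [R[i]], a positive radius is real, so a real epsilon suffices. *)
rewrite ltcE /= => /andP[/eqP-> e0].
have e2 : 0 < e / 2 by rewrite divr_gt0.
move/cvgrPdist_lt: ua => /(_ _ e2) ua; move/cvgrPdist_lt: ub => /(_ _ e2) ub.
near=> n.
rewrite normc_norm ltcE /= eqxx /=; apply: le_lt_trans (normc_le_ReIm _) _.
have -> : complex.Re ((a +i* b)%C - u n) = a - complex.Re (u n) by case: (u n).
have -> : complex.Im ((a +i* b)%C - u n) = b - complex.Im (u n) by case: (u n).
rewrite (splitr e) ltrD //.
  by near: n.
by near: n.
Unshelve. all: by end_near.
Qed.

Lemma cvgc_normc (u : nat -> R[i]) (l : R[i]) :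
  u @ \oo --> l -> (fun n => normc (u n)) @ \oo --> normc l.
Proof.
move=> ul; apply/cvgrPdist_lt => e e0.
move/cvgrPdist_lt: ul => /(_ e%:C%C); rewrite ltcR => /(_ e0).
apply: filterS => n; rewrite normc_norm ltcR; apply: le_lt_trans.
have := le_normcD (l - u n) (u n); have := le_normcD (u n - l) l.
rewrite !subrK ler_norml (_ : normc (u n - l) = normc (l - u n)); first by lra.
by rewrite -opprB; exact: normcN.
Qed.

(** The sequence is its first term plus the partial sums of its increments, and these converge
    absolutely by comparison with [g]. *)
Lemma is_cvg_dominated_steps (u g : nat -> R) :
  (forall n, `|u n.+1 - u n| <= g n) -> cvgn (series g) -> cvgn u.
Proof.
move=> ug cg.
have /cvg_ex[l cu] : cvgn (series (telescope u)).
  apply: normed_cvg; apply: (series_le_cvg _ _ ug cg) => n //.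
  by apply: le_trans (ug n).
apply/cvg_ex; exists (u 0%N + l).
have uE : (fun n => u 0%N + series (telescope u) n) = u.
  by apply/funext => n; rewrite -eq_sum_telescope.
have c0 : (fun _ : nat => u 0%N) @ \oo --> u 0%N by exact: cvg_cst.
rewrite -[X in X @ _]uE; exact: (cvgD c0 cu).
Qed.

Lemma is_cvgc_dominated_steps (u : nat -> R[i]) (g : nat -> R) :
  (forall n, normc (u n.+1 - u n) <= g n) -> cvgn (series g) -> cvgn u.
Proof.
move=> ug cg.
have /cvg_ex[a ua] : cvgn (@complex.Re R \o u).
  apply: is_cvg_dominated_steps cg => n; apply: le_trans (ug n).
  by rewrite -ReB Re_le_normc.
have /cvg_ex[b ub] : cvgn (@complex.Im R \o u).
  apply: is_cvg_dominated_steps cg => n; apply: le_trans (ug n).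
  by rewrite -ImB Im_le_normc.
by apply/cvg_ex; exists (a +i* b)%C; exact: cvgc_ReIm.
Qed.

Lemma is_cvg_seriesc (f : nat -> R[i]) (g : nat -> R) :
  (forall n, normc (f n) <= g n) -> cvgn (series g) -> cvgn (series f).
Proof.
move=> fg; apply: is_cvgc_dominated_steps => n.
rewrite /series /= big_nat_recr //= addrAC subrr add0r; exact: fg.
Qed.

End Modulus.

(** * Taylor estimate for the complex exponential *)

Section Cexp.
Context {R : realType}.

(** The derivative is bounded only for [|x| <= |b|], so that [M] may be [|b|] itself; this is how
    the quadratic bounds on [cos] and [sin] arise. *)
Lemma MVT_bound (f df : R -> R) (M b : R) :
  (forall x : R, is_derive x 1 f (df x)) ->
  (forall x : R, `|x| <= `|b| -> `|df x| <= M) -> `|f b - f 0| <= M * `|b|.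
Proof.
move=> fdf dfM.
have cf : continuous f.
  move=> x; apply/differentiable_continuous/derivable1_diffP.
  exact: ex_derive.
have [b0|b0] := leP 0 b.
  have [c] := @MVT_segment R f df 0 b b0 (fun x _ => fdf x)
    (continuous_subspaceT cf).
  rewrite in_itv /= subr0 => /andP[c0 cb] ->.
  by rewrite normrM ler_wpM2r // dfM // !ger0_norm.
have [c] := @MVT_segment R f df b 0 (ltW b0) (fun x _ => fdf x)
  (continuous_subspaceT cf).
rewrite in_itv /= sub0r distrC => /andP[bc c0] ->.
by rewrite normrM normrN ler_wpM2r // dfM // !ler0_norm ?lerN2 // ltW.
Qed.

(** The quadratic bound enters the Taylor estimate of [cexp]; the linear one bounds the derivative
    of [sin x - x] in [sinBid_le]. *)
Lemma cosB1_le (b : R) : `|cos b - 1| <= `|b| ^+ 2 /\ `|cos b - 1| <= `|b|.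
Proof.
have sle (x : R) : `|sin x| <= `|x|.
  have := @MVT_bound sin cos 1 x _ (fun y _ => cos_max y).
  by rewrite sin0 subr0 mul1r; apply => y; exact: is_derive_sin.
split.
  have := @MVT_bound cos (fun y => - sin y) `|b| b.
  rewrite cos0 -expr2; apply => // y yb.
  by rewrite normrN; exact: le_trans (sle y) yb.
have := @MVT_bound cos (fun y => - sin y) 1 b.
by rewrite cos0 mul1r; apply => // y _; rewrite normrN sin_max.
Qed.

Lemma sinBid_le (b : R) : `|sin b - b| <= `|b| ^+ 2.
Proof.
have := @MVT_bound (fun x => sin x - x) (fun y => cos y - 1) `|b| b.
rewrite sin0 !subr0 -expr2; apply => y yb.
by apply: le_trans yb; exact: (cosB1_le y).2.
Qed.

Lemma normc_cexp (z : R[i]) : normc (cexp z) = expR (complex.Re z).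
Proof.
by rewrite /= !exprMn -mulrDr cos2Dsin2 mulr1 sqrtr_sqr ger0_norm // expR_ge0.
Qed.

Lemma cexpD (z w : R[i]) : cexp (z + w) = cexp z * cexp w.
Proof.
case: z w => [a b] [c d]; rewrite /cexp /= expRD cosD sinD.
by apply/eqP; rewrite eq_complex /=; apply/andP; split; apply/eqP; ring.
Qed.

Lemma cexp_taylor1 (w : R[i]) : 0 <= complex.Re w ->
  normc (cexp w - 1 - w) <= 4 * expR (complex.Re w) * normc w ^+ 2.
Proof.
case: w => a b; rewrite [complex.Re _]/= => a0.
set E := expR a.
(* Together, [E1] and [E2] give [0 <= E - 1 <= E * a], hence
   [E - 1 - a <= a * (E - 1) <= E * a ^+ 2]. *)
have E1 : 1 + a <= E by exact: expR_ge1Dx.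
have E2 : E * (1 - a) <= 1.
  rewrite -[leRHS](expRxMexpNx_1 a) ler_wpM2l ?expR_ge0 //.
  exact: (expR_ge1Dx (- a)).
have [C1 _] := cosB1_le b; have S1 := sinBid_le b.
have -> : cexp (a +i* b)%C - 1 - (a +i* b)%C =
  ((E - 1 - a + E * (cos b - 1)) +i* ((E - 1) * b + E * (sin b - b)))%C.
  apply/eqP; rewrite eq_complex /=; apply/andP.
  by split; apply/eqP; rewrite /E; ring.
apply: le_trans (normc_le_ReIm _) _ => /=.
rewrite -/(normc (a +i* b)%C) sqr_normcE /=.
have nb2 : `|b| ^+ 2 = b ^+ 2 by rewrite real_normK ?num_real.
have n1 : `|E - 1 - a + E * (cos b - 1)| <= E * a ^+ 2 + E * b ^+ 2.
  apply: le_trans (ler_normD _ _) _; apply: lerD.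
    by rewrite ger0_norm; nra.
  rewrite normrM (ger0_norm (expR_ge0 a)) ler_wpM2l ?expR_ge0 //.
  by rewrite -nb2.
have n2 : `|(E - 1) * b + E * (sin b - b)| <= E * (a * `|b|) + E * b ^+ 2.
  apply: le_trans (ler_normD _ _) _; apply: lerD.
    rewrite normrM mulrA ler_wpM2r // ger0_norm; nra.
  rewrite normrM (ger0_norm (expR_ge0 a)) ler_wpM2l ?expR_ge0 //.
  by rewrite -nb2.
apply: le_trans (lerD n1 n2) _.
have E0 : 0 < E by exact: expR_gt0.
have ab : a * `|b| <= a ^+ 2 + b ^+ 2.
  by rewrite -nb2; have := sqr_ge0 (a - `|b|); have := normr_ge0 b; nra.
have := sqr_ge0 a; have := sqr_ge0 b; nra.
Qed.

End Cexp.

(** * Convergence of Gauss' product in the right half-plane *)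

Section GammaLimit.
Context {R : realType}.

Lemma natV_succB n :
  n.+1%:R^-1 - n.+2%:R^-1 = n.+1%:R^-1 * n.+2%:R^-1 :> R.
Proof.
rewrite -[n.+2%:R]natr1; have : 0 < n.+1%:R :> R by rewrite ltr0n.
move: (n.+1%:R : R) => a a0; field.
by rewrite !lt0r_neq0 // addr_gt0.
Qed.

(** Summable relative steps keep [u] bounded, and then its absolute steps are summable too. The
    O(1/n^2) majorant is written as a difference of reciprocals so that its sums telescope. *)
Lemma is_cvgc_quadratic_steps (u : nat -> R[i]) (C : R) : 0 <= C ->
  (forall n, normc (u n.+1 - u n)
     <= C * (n.+1%:R^-1 - n.+2%:R^-1) * normc (u n)) ->
  cvgn u.
Proof.
move=> C0 uC; pose K := normc (u 0%N) * expR C.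
have K0 : 0 <= K by rewrite mulr_ge0 ?normc_ge0 ?expR_ge0.
have d0 n : 0 <= n.+1%:R^-1 - n.+2%:R^-1 :> R.
  by rewrite subr_ge0 lef_pV2 ?posrE ?ltr0n // ler_nat.
(* [normc (u n) * expR (C / (n + 1))] is nonincreasing, so [u] is bounded. *)
have un n : normc (u n) * expR (C * n.+1%:R^-1) <= K.
  elim: n => [|n]; first by rewrite invr1 mulr1.
  apply: le_trans.
  have -> : C * n.+1%:R^-1 = C * (n.+1%:R^-1 - n.+2%:R^-1) + C * n.+2%:R^-1.
    by ring.
  rewrite expRD mulrA ler_wpM2r ?expR_ge0 //.
  have -> : u n.+1 = u n + (u n.+1 - u n) by ring.
  apply: le_trans (le_normcD _ _) _; apply: le_trans (lerD (lexx _) (uC n)) _.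
  rewrite -[X in X + _]mul1r -mulrDl mulrC ler_wpM2l ?normc_ge0 //.
  exact: expR_ge1Dx.
have uK n : normc (u n) <= K.
  apply: le_trans (un n); rewrite ler_peMr ?normc_ge0 //.
  by apply: le_trans (expR_ge1Dx _); rewrite lerDl mulr_ge0.
apply: (@is_cvgc_dominated_steps R u
  (fun n => K * C * (n.+1%:R^-1 - n.+2%:R^-1))).
  move=> n; apply: le_trans (uC n) _; rewrite mulrC mulrA.
  by rewrite ler_wpM2r // ler_wpM2r.
apply: nondecreasing_is_cvgn.
  by apply: nondecreasing_series => n _; rewrite mulr_ge0 // mulr_ge0.
exists (K * C) => _ [n _ <-].
have -> : series (fun n => K * C * (n.+1%:R^-1 - n.+2%:R^-1)) n
    = K * C * (1 - n.+1%:R^-1).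
  elim: n => [|n IH]; first by rewrite /series /= big_geq // invr1 subrr mulr0.
  rewrite /series /= big_nat_recr //= -/(series _ n) in IH *.
  by rewrite IH; ring.
apply: ler_piMr; first exact: mulr_ge0.
by rewrite lerBlDr lerDl invr_ge0 ler0n.
Qed.

Lemma lnB_le (a b : R) : 0 < a -> 0 < b -> ln a - ln b <= a / b - 1.
Proof.
move=> a0 b0; rewrite -ln_div ?posrE //.
have ab : 0 < a / b by rewrite divr_gt0.
by have := @le_ln1Dx R (a / b - 1); rewrite [1 + _]addrC subrK; apply; lra.
Qed.

(** Both bounds are [ln y <= y - 1], taken at the quotient of the two integers and at its
    inverse. *)
Lemma lnS_bounds n :
  n.+2%:R^-1 <= ln n.+2%:R - ln n.+1%:R :> R /\
  ln n.+2%:R - ln n.+1%:R <= n.+1%:R^-1 :> R.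
Proof.
have n1 : 0 < n.+1%:R :> R by rewrite ltr0n.
have n2 : 0 < n.+2%:R :> R by rewrite ltr0n.
have E : n.+2%:R = n.+1%:R + 1 :> R by rewrite -natr1.
split.
  rewrite -lerN2 opprB; apply: le_trans (lnB_le _ _ n1 n2) _.
  rewrite le_eqVlt E; apply/orP; left; apply/eqP; field.
  by rewrite -?E lt0r_neq0.
apply: le_trans (lnB_le _ _ n2 n1) _.
by rewrite le_eqVlt E; apply/orP; left; apply/eqP; field; rewrite lt0r_neq0.
Qed.

Definition gauss (z : R[i]) (n : nat) : R[i] :=
  n`!%:R * cexp (z * (ln n%:R)%:C%C) / \prod_(i < n.+1) (z + i%:R).

Lemma realcB_natV (x : R) n : (x - n%:R^-1)%:C%C = x%:C%C - n%:R^-1 :> R[i].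
Proof. by rewrite rmorphB /= fmorphV rmorph_nat. Qed.

Section RightHalfPlane.
Variable z : R[i].
Hypothesis z0 : 0 < complex.Re z.

Lemma ReD_gt0 n : 0 < complex.Re (z + n%:R).
Proof. by rewrite ReD Re_nat; apply: ltr_wpDr. Qed.

Lemma addn_neq0 n : z + n%:R != 0.
Proof. by apply/eqP => E; have := ReD_gt0 n; rewrite E ltxx. Qed.

Lemma normc_addn n : n%:R <= normc (z + n%:R).
Proof.
apply: le_trans (Re_le_normc _); apply: le_trans (ler_norm _).
by rewrite ReD Re_nat lerDr ltW.
Qed.

(** With N = n + 2, the relative increment is N / (z + N) times [cexp (z * L) - 1 - z / N].
    Inserting [z * L] splits the latter into a Taylor remainder and the error of 1/N as an
    approximation of [L], both O(1/n^2). *)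
Lemma gaussSB n (L := ln n.+2%:R - ln n.+1%:R) :
  gauss z n.+2 - gauss z n.+1 =
  gauss z n.+1 * (n.+2%:R / (z + n.+2%:R)) *
    ((cexp (z * L%:C%C) - 1 - z * L%:C%C) + z * (L - n.+2%:R^-1)%:C%C).
Proof.
have E : cexp (z * (ln n.+2%:R)%:C%C) =
    cexp (z * (ln n.+1%:R)%:C%C) * cexp (z * L%:C%C).
  by rewrite -cexpD -mulrDr -rmorphD /= addrC subrK.
rewrite /gauss big_ord_recr /= [n.+2`!]factS natrM E.
have P0 : \prod_(i < n.+2) (z + i%:R) != 0.
  by apply/prodf_neq0 => i _; exact: addn_neq0.
move: (cexp (z * (ln n.+1%:R)%:C%C)) => e1; move: (cexp (z * L%:C%C)) => e2.
clearbody L; rewrite realcB_natV.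
have := addn_neq0 n.+2.
have n2 : (n.+2%:R : R[i]) != 0 by rewrite pnatr_eq0.
move: P0 n2; move: (\prod_(i < n.+2) (z + i%:R)) => P.
move: (n.+2%:R : R[i]) => N; move: (n.+1`!%:R : R[i]) => F; move: (L%:C%C) => l.
by move=> P0 N0 zN; field; rewrite N0 zN P0.
Qed.

Lemma is_cvg_gauss : cvgn (gauss z).
Proof.
pose x := complex.Re z; pose a := normc z.
have a0 : 0 <= a by exact: normc_ge0.
suff /cvg_ex[l cl] : cvgn (fun n => gauss z n.+1).
  by apply/cvg_ex; exists l; rewrite -cvg_shiftS.
(* The first summand is the Taylor constant 4 times the 2 of the estimate [d] below; the second
   comes from [z * (L - n.+2%:R^-1)]. *)
apply: (@is_cvgc_quadratic_steps _ (8 * expR x * a ^+ 2 + a)).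
  by rewrite addr_ge0 // mulr_ge0 ?sqr_ge0 // mulr_ge0 ?expR_ge0.
move=> n /=.
have [L1 L2] := lnS_bounds n; rewrite gaussSB.
set L := ln n.+2%:R - ln n.+1%:R in L1 L2 *.
move: (gauss z n.+1) => g.
rewrite !normcM -mulrA mulrC ler_wpM2r ?normc_ge0 //.
have n2 : 0 < n.+2%:R :> R by rewrite ltr0n.
have n1 : 0 < n.+1%:R :> R by rewrite ltr0n.
have q1 : normc (n.+2%:R) * normc (z + n.+2%:R)^-1 <= 1.
  rewrite normcV normc_nat ler_pdivrMr ?mul1r ?normc_addn //.
  exact: lt_le_trans (normc_addn _).
apply: (@le_trans _ _ (1 * normc (cexp (z * L%:C%C) - 1 - z * L%:C%C
    + z * (L - n.+2%:R^-1)%:C%C))).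
  by rewrite ler_wpM2r ?normc_ge0.
rewrite mul1r; apply: le_trans (le_normcD _ _) _.
have p2 : 0 < n.+2%:R^-1 :> R by rewrite invr_gt0.
have p1 : 0 < n.+1%:R^-1 :> R by rewrite invr_gt0.
have L0 : 0 < L by exact: lt_le_trans L1.
have p11 : n.+1%:R^-1 <= 1 :> R by rewrite invf_le1 // ler1n.
have d : n.+1%:R^-1 ^+ 2 <= 2 * (n.+1%:R^-1 - n.+2%:R^-1) :> R.
  rewrite natV_succB.
  have : n.+1%:R^-1 <= 2 * n.+2%:R^-1 :> R.
    rewrite ler_pdivlMr // mulrC ler_pdivrMr //.
    by rewrite -natrM ler_nat mulSn mul1n addSn ltnS leq_addl.
  by move=> h; rewrite expr2 mulrCA ler_wpM2l ?(ltW p1).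
have ReL : complex.Re (z * L%:C%C) = x * L.
  by rewrite /x; case: (z) => p q /=; rewrite mulr0 subr0.
have nL : normc (z * L%:C%C) = a * L.
  by rewrite normcM normc_real gtr0_norm.
have := @cexp_taylor1 R (z * L%:C%C); rewrite ReL nL.
move=> /(_ (mulr_ge0 (ltW z0) (ltW L0))) T.
have eL : expR (x * L) <= expR x.
  by rewrite ler_expR (ler_piMr (ltW z0) (le_trans L2 p11)).
rewrite mulrDl; apply: lerD.
  apply: le_trans T _; rewrite exprMn.
  have L2' : L ^+ 2 <= 2 * (n.+1%:R^-1 - n.+2%:R^-1).
    by apply: le_trans d; rewrite lerXn2r ?nnegrE ?(ltW L0) ?(ltW p1).
  have -> : 8 * expR x * a ^+ 2 * (n.+1%:R^-1 - n.+2%:R^-1) =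
    4 * expR x * (a ^+ 2 * (2 * (n.+1%:R^-1 - n.+2%:R^-1))) :> R by ring.
  have e0 := expR_ge0 (x * L).
  apply: ler_pM.
  - by rewrite mulr_ge0.
  - by rewrite mulr_ge0 ?sqr_ge0.
  - by rewrite ler_wpM2l.
  - by rewrite ler_wpM2l ?sqr_ge0.
rewrite normcM normc_real ger0_norm ?subr_ge0 // ler_wpM2l //.
by rewrite lerD2r.
Qed.

End RightHalfPlane.
End GammaLimit.

(** * A lower bound for the modulus of Gamma *)

Section GammaLower.
Context {R : realType}.

Lemma bin_le_exp2 n m : ('C(n, m) <= 2 ^ n)%N.
Proof.
elim: n m => [|n IH] [|m] //; first by rewrite bin0 expn_gt0.
by rewrite binS expnS mul2n -addnn leq_add.
Qed.

Lemma harmonicS n :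
  series harmonic n.+1 = series harmonic n + n.+1%:R^-1 :> R.
Proof. by rewrite seriesSr. Qed.

Lemma ln_le_harmonic n : ln n.+1%:R <= series harmonic n :> R.
Proof.
elim: n => [|n IH]; first by rewrite ln1 /series /= big_geq.
rewrite harmonicS -lerBlDl; have [_ L] := @lnS_bounds R n.
by apply: le_trans L; rewrite lerB.
Qed.

Lemma harmonic_le_ln n : series harmonic n.+1 <= 1 + ln n.+1%:R :> R.
Proof.
elim: n => [|n IH].
  by rewrite /series /= big_nat1 ln1 addr0 /harmonic /= invr1.
have [L _] := @lnS_bounds R n; rewrite harmonicS.
by apply: le_trans (lerD IH L) _; rewrite -addrA subrKC.
Qed.

(** By the triangle inequality each factor is at most m + i + 1, and the product of these is the
    falling factorial (m + n)! / m!. *)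
Lemma prod_normc_le_fact (z : R[i]) (m n : nat) : normc z <= m%:R ->
  \prod_(i < n) normc (z + i.+1%:R) <= n`!%:R * 'C(m + n, n)%:R.
Proof.
move=> zm; rewrite -natrM mulnC bin_ffact.
elim: n => [|n IH]; first by rewrite big_ord0 ffactn0.
rewrite big_ord_recr /= ffactnS addnS -[_.+1.-1]/(m + n)%N -addnS mulnC natrM.
apply: ler_pM => //.
- by rewrite prodr_ge0 // => i _; exact: normc_ge0.
- exact: normc_ge0.
- by apply: le_trans (le_normcD _ _) _; rewrite normc_nat natrD lerD2r.
Qed.

(** With N = n + 2 and x = Re z, |z + N|^2 <= N^2 (1 + 2x/N + m^2/N^2), and [1 + y <= expR y]
    applies. Bounding 1/N^2 by 1/(N - 1) - 1/N makes the exponents telescope over N. *)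
Lemma normc_addS_le (z : R[i]) (m n : nat) : normc z <= m%:R ->
  normc (z + n.+2%:R) <= n.+2%:R * expR (complex.Re z * n.+2%:R^-1
    + m%:R ^+ 2 * (n.+1%:R^-1 - n.+2%:R^-1)).
Proof.
move=> zm; set N : R := n.+2%:R; set x := complex.Re z.
have N0 : 0 < N by rewrite ltr0n.
have n1 : 0 < n.+1%:R :> R by rewrite ltr0n.
have d : N^-1 ^+ 2 <= n.+1%:R^-1 - N^-1.
  rewrite natV_succB expr2 ler_wpM2r ?invr_ge0 ?(ltW N0) //.
  by rewrite lef_pV2 ?posrE // ler_nat.
have e0 y : 0 <= expR y :> R := expR_ge0 y.
rewrite -(ler_sqr (normc_ge0 _) (mulr_ge0 (ltW N0) (e0 _))) exprMn.
rewrite -expRM_natl sqr_normcE.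
apply: (@le_trans _ _
  (N ^+ 2 * (1 + (2 * (x * N^-1) + m%:R ^+ 2 * N^-1 ^+ 2)))).
  have zm2 : x ^+ 2 + complex.Im z ^+ 2 <= m%:R ^+ 2.
    by rewrite -sqr_normcE ler_sqr ?nnegrE ?normc_ge0 ?ler0n.
  rewrite ReD Re_nat ImD Im_nat addr0 -/x -/N.
  have -> : N ^+ 2 * (1 + (2 * (x * N^-1) + m%:R ^+ 2 * N^-1 ^+ 2)) =
     N ^+ 2 + 2 * x * N + m%:R ^+ 2 by field; rewrite lt0r_neq0.
  by have -> : (x + N) ^+ 2 = x ^+ 2 + 2 * x * N + N ^+ 2; [ring|lra].
rewrite ler_wpM2l ?sqr_ge0 //; apply: le_trans (expR_ge1Dx _) _.
rewrite ler_expR.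
move: (n.+1%:R^-1 - N^-1) d => D d.
have := ler_wpM2l (sqr_ge0 (m%:R : R)) d.
have := mulr_ge0 (sqr_ge0 (m%:R : R)) (le_trans (sqr_ge0 _) d).
move: (x / N) (_ * D) (_ * N^-1 ^+ 2) => p q r q0 rq.
by rewrite mulrDr lerD2l; apply: le_trans rq _; lra.
Qed.

Lemma prod_normc_le (z : R[i]) (m k : nat) (n := (m + k).+1) :
  normc z <= m.+1%:R ->
  \prod_(i < n) normc (z + i.+1%:R) <=
    n`!%:R * ((2 ^ (m.+1 + m.+1))%:R *
      expR (complex.Re z * (series harmonic n - series harmonic m.+1)
        + m.+1%:R ^+ 2 * (m.+1%:R^-1 - n%:R^-1))).
Proof.
move=> zm; rewrite {}/n; elim: k => [|k IH].
  (* Base case: only the first m + 1 factors, where the binomial bound is used. Each later factor is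
     handled by [normc_addS_le]. *)
  rewrite addn0 !subrr !mulr0 addr0 expR0 mulr1.
  apply: le_trans (prod_normc_le_fact z m.+1 m.+1 zm) _.
  by rewrite ler_wpM2l // ler_nat bin_le_exp2.
rewrite addnS; move: (m + k)%N IH => n IH.
rewrite big_ord_recr /=.
apply: le_trans (ler_pM _ (normc_ge0 _) IH (normc_addS_le z m.+1 _ zm)) _.
  by rewrite prodr_ge0 // => i _; exact: normc_ge0.
rewrite {IH} le_eqVlt; apply/orP; left; apply/eqP.
rewrite [n.+2`!]factS natrM [series _ n.+2]harmonicS.
have E (a b c d e h h0 : R) : a * (h + e - h0) + b * (c - e)
    = (a * (h - h0) + b * (c - d)) + (a * e + b * (d - e)) by ring.
have A (F T e1 a e2 : R) : F * (T * e1) * (a * e2) = a * F * (T * (e1 * e2)).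
  by ring.
by rewrite [in RHS](E _ _ _ n.+1%:R^-1) [in RHS]expRD A.
Qed.

(** The bound holds for every Gauss term of index n >= m + 1, uniformly in n, because n^(Re z) in
    the numerator balances exp (Re z H_n) from the denominator; it then passes to the limit. The
    integer [m] stays free so that it can later grow linearly with the summation index. *)
Lemma normc_cGamma_ge (z : R[i]) (m : nat) : 0 < complex.Re z ->
  normc z <= m.+1%:R ->
  expR (complex.Re z * ln m.+1%:R - 5 * m.+1%:R) <= normc (cGamma z).
Proof.
move=> z0 zm; have /cvgc_normc cG : gauss z @ \oo --> cGamma z.
  exact: is_cvg_gauss.
have {}cG : (fun k => normc (gauss z (k + m.+1)%N)) @ \oo --> normc (cGamma z).
  by rewrite (cvg_shiftn m.+1 (fun n => normc (gauss z n))).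
have cv : cvgn (fun k => normc (gauss z (k + m.+1)%N)) by exact: cvgP cG.
rewrite -(cvg_lim _ cG) //; apply: limr_ge => //.
apply: nearW => k; rewrite addnC /gauss.
have := prod_normc_le z m k zm; rewrite -addSn; set n := (m.+1 + k)%N => P.
have n0 : n = n.-1.+1 by rewrite /n addSn.
set x := complex.Re z; set M : R := m.+1%:R.
(* The factor of index 0 is [z] itself, bounded by [M]; the other n factors are those of
   [prod_normc_le]. *)
rewrite big_ord_recl /= addr0 !normcM normc_nat normcV normcM normc_prod.
rewrite normc_cexp.
under eq_bigr do rewrite /bump /= add1n.
have -> : complex.Re (z * (ln n%:R)%:C%C) = x * ln n%:R.
  by rewrite /x; case: (z) => p q /=; rewrite mulr0 subr0.
have zn : 0 < normc z.
  apply: lt_le_trans z0 _; exact: le_trans (ler_norm _) (Re_le_normc _).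
have Pp : 0 < \prod_(i < n) normc (z + i.+1%:R).
  rewrite prodr_gt0 // => i _; apply: lt_le_trans (normc_addn z z0 _).
  by rewrite ltr0n.
rewrite ler_pdivlMr ?mulr_gt0 //.
apply: (le_trans (ler_wpM2l (expR_ge0 _) (ler_pM (ltW zn) (ltW Pp) zm P))).
have F0 : 0 < n`!%:R :> R by rewrite ltr0n fact_gt0.
have A (e f t q : R) : e * (M * (f * (t * q))) = f * (e * M * t * q) by ring.
rewrite A ler_wpM2l ?(ltW F0) //.
have M0 : 0 < M by rewrite ltr0n.
have xM : x <= M.
  by apply: le_trans zm; apply: le_trans (ler_norm _) (Re_le_normc _).
have e0 y : 0 <= expR y :> R := expR_ge0 y.
have Me : M <= expR M by apply: le_trans (expR_ge1Dx _); rewrite lerDr.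
have Te : (2 ^ (m.+1 + m.+1))%:R <= expR (M + M).
  rewrite -natrD -[X in expR X]mul1r expRM_natr natrX lerXn2r ?nnegrE //.
  by have := expR_ge1Dx (1 : R); rewrite -[1 + 1]/(2 : R).
apply: (@le_trans _ _ (expR (x * ln M - 5 * M) * expR M * expR (M + M) *
    expR (x * (series harmonic n - series harmonic m.+1)
      + M ^+ 2 * (M^-1 - n%:R^-1)))).
  by rewrite ler_wpM2r // ler_pM ?mulr_ge0 ?(ltW M0) ?ler0n // ler_wpM2l.
rewrite -!expRD ler_expR.
have M2 : M ^+ 2 * (M^-1 - n%:R^-1) <= M.
  rewrite mulrBr expr2 -mulrA divff ?lt0r_neq0 // mulr1.
  by rewrite lerBlDr lerDl !mulr_ge0 ?invr_ge0 ?ler0n ?(ltW M0).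
have Hn : series harmonic n <= 1 + ln n%:R :> R.
  by rewrite n0; exact: harmonic_le_ln.
have Hm : ln M <= series harmonic m.+1 :> R.
  apply: le_trans (ln_le_harmonic _).
  by rewrite ler_ln ?posrE ?ltr0n // ler_nat.
have H : x * (series harmonic n - series harmonic m.+1)
    <= x + x * ln n%:R - x * ln M.
  apply: le_trans (ler_wpM2l (ltW z0) (lerB Hn Hm)) _.
  by rewrite mulrBr mulrDr mulr1.
(* The constant 5 counts copies of [M]: one for [M <= expR M], two for 4^M, one for [M2], and one
   for [x <= M] in the gap between harmonic sums and logarithms. *)
have conclude (p q r s y L : R) : p <= L -> y <= L -> q <= y + s - r ->
  r - 5 * L + L + (L + L) + (q + p) <= s by lra.
exact: conclude M2 xM H.
Qed.

(** k ln k outgrows every linear function of k: multiply [1 + y <= expR y] at y = c - ln k by k. For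
    k = 0 the right-hand side is 0. *)
Lemma mulr_ln_ge (c : R) (k : nat) :
  k%:R * (c + 1) - expR c <= k%:R * ln k%:R.
Proof.
case: k => [|k]; first by rewrite !mul0r sub0r oppr_le0 expR_ge0.
have k0 : 0 < k.+1%:R :> R by rewrite ltr0n.
have := expR_ge1Dx (c - ln k.+1%:R); rewrite expRB lnK ?posrE // => h.
have := ler_wpM2l (ltW k0) h; rewrite mulrCA divff ?lt0r_neq0 // mulr1.
move: (k.+1%:R) (ln _) => K l; rewrite !mulrDr mulr1 mulrN; lra.
Qed.

End GammaLower.

(** * The complex Prabhakar series *)

Section ComplexPrabhakar.
Context {R : realType}.

(** Factor by factor, |d + i| <= (i + 1)(1 + |d|). *)
Lemma poch_fact_le (d : R[i]) (k : nat) :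
  normc (\prod_(i < k) (d + i%:R)) <= k`!%:R * (1 + normc d) ^+ k.
Proof.
have d0 := normc_ge0 d.
rewrite normc_prod; elim: k => [|k IH]; first by rewrite big_ord0 mulr1.
rewrite big_ord_recr /= factS natrM exprSr [k.+1%:R * _]mulrC mulrACA.
apply: ler_pM => //; first by rewrite prodr_ge0 // => i _; exact: normc_ge0.
  exact: normc_ge0.
apply: le_trans (le_normcD _ _) _; rewrite normc_nat -natr1.
by have : 0 <= k%:R :> R by []; nra.
Qed.

Lemma cGamma_neq0 (z : R[i]) : 0 < complex.Re z -> cGamma z != 0.
Proof.
move=> z0; have zm := archi_boundP (normc_ge0 z).
have zm' : normc z <= (Num.bound (normc z)).+1%:R.
  by apply: le_trans (ltW zm) _; rewrite ler_nat.
have := lt_le_trans (expR_gt0 _) (@normc_cGamma_ge R z _ z0 zm').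
by apply: contraTneq => ->; rewrite normc0 ltxx.
Qed.

Lemma is_cvg_prabhakarc (s t d w : R[i]) :
  0 < complex.Re s -> 0 < complex.Re t ->
  cvgn (series (fun k : nat => (\prod_(i < k) (d + i%:R)) /
    (k`!%:R * cGamma (s * k%:R + t)) * w ^+ k)).
Proof.
move=> s0 t0; set a := complex.Re s.
(* These give |s k + t| <= A k + B. The successor ensures [A >= 1], hence k <= A k + B, as the
   comparison of logarithms [lnm] requires. *)
pose A := (Num.bound (normc s)).+1; pose B := Num.bound (normc t).
have sA : normc s <= A%:R.
  by apply: le_trans (ltW (archi_boundP (normc_ge0 s))) _; rewrite ler_nat.
have tB : normc t <= B%:R := ltW (archi_boundP (normc_ge0 t)).
pose M := (1 + normc d) * normc w.
have M0 : 0 <= M by rewrite mulr_ge0 ?normc_ge0 // addr_ge0 ?normc_ge0.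
(* Chosen so that [a * (c + 1) = M + 5 * A + 1]: this pays for the growth [M ^+ k], for the loss
   [5 * A * k] in the Gamma bound, and leaves the ratio [expR (-1)]. The constant [K] collects what
   does not depend on k. *)
pose c := (M + 5 * A%:R + 1) / a - 1.
pose K := expR (a * expR c + 5 * (B%:R + 1)).
apply: (@is_cvg_seriesc _ _ (geometric K (expR (-1)))); last first.
  apply: is_cvg_geometric_series.
  by rewrite ger0_norm ?expR_ge0 // expR_lt1 ltrN10.
move=> k; set z := s * k%:R + t; pose m := (A * k + B)%N.
have Rez : complex.Re z = a * k%:R + complex.Re t by rewrite ReD ReM_nat.
have z0 : 0 < complex.Re z.
  by rewrite Rez; apply: ltr_wpDl => //; rewrite mulr_ge0 ?(ltW s0).
have zm : normc z <= m.+1%:R.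
  apply: le_trans (le_normcD _ _) _.
  rewrite normcM normc_nat /m -addnS natrD natrM.
  apply: lerD; first by rewrite ler_wpM2r.
  by apply: le_trans tB _; rewrite ler_nat.
have G := @normc_cGamma_ge R z m z0 zm.
have lnm : ln k%:R <= ln m.+1%:R :> R.
  rewrite /m; case: (k) => [|k']; first by rewrite ln0 // ln_ge0 // ler1n.
  rewrite ler_ln ?posrE ?ltr0n // ler_nat ltnW // ltnS.
  by rewrite (leq_trans _ (leq_addr _ _)) // leq_pmull.
have lnm0 : 0 <= ln m.+1%:R :> R by rewrite ln_ge0 // ler1n.
have low : a * (k%:R * ln k%:R) <= complex.Re z * ln m.+1%:R.
  rewrite mulrA Rez mulrDl.
  apply: ler_wpDr; first by rewrite mulr_ge0 ?(ltW t0).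
  by rewrite ler_wpM2l // mulr_ge0 ?(ltW s0).
have E := @mulr_ln_ge R c k.
have {E}low :
    k%:R * (M + 5 * A%:R + 1) - a * expR c <= complex.Re z * ln m.+1%:R.
  apply: le_trans low; apply: le_trans (ler_wpM2l (ltW s0) E).
  rewrite le_eqVlt; apply/orP; left; apply/eqP.
  by rewrite -/a /c; field; rewrite lt0r_neq0.
have F0 : 0 < k`!%:R :> R by rewrite ltr0n fact_gt0.
have G0 : 0 < normc (cGamma z) by exact: lt_le_trans (expR_gt0 _) G.
rewrite !normcM normcV normcM normc_nat normcX mulrAC ler_pdivrMr ?mulr_gt0 //.
apply: le_trans (ler_wpM2r (exprn_ge0 _ (normc_ge0 _)) (poch_fact_le d k)) _.
rewrite -mulrA -exprMn -/M mulrCA ler_wpM2l ?(ltW F0) //.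
apply: (@le_trans _ _ (expR (M * k%:R))).
  rewrite expRM_natr lerXn2r ?nnegrE ?expR_ge0 //.
  by apply: le_trans (expR_ge1Dx _); rewrite lerDr.
apply: le_trans (ler_wpM2l _ G); last first.
  by rewrite mulr_ge0 ?expR_ge0 // exprn_ge0 ?expR_ge0.
rewrite /= -expRM_natr -!expRD ler_expR.
have mE : m.+1%:R = A%:R * k%:R + (B%:R + 1) :> R.
  by rewrite -addnS natrD natrM -[B.+1%:R]natr1.
have conclude (M1 A1 b e l p : R) : l * (M1 + 5 * A1 + 1) - e <= p ->
  M1 * l <= e + 5 * b + -1 * l + (p - 5 * (A1 * l + b)) by lra.
by rewrite {2}mE; exact: conclude low.
Qed.

End ComplexPrabhakar.

(** * Idempotent components and the bicomplex series *)

Section Idempotent.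
Context {R : realType}.
Implicit Types u v : bicomplex R.

Lemma bc_fst_is_zmod_morphism : zmod_morphism (@bc_fst R).
Proof. by move=> u v; rewrite /bc_fst /=; ring. Qed.

Lemma bc_snd_is_zmod_morphism : zmod_morphism (@bc_snd R).
Proof. by move=> u v; rewrite /bc_snd /=; ring. Qed.

Lemma i_sqr : 'i%C * 'i%C = -1 :> R[i].
Proof. by rewrite -expr2 sqr_i. Qed.

Lemma bc_fst_is_monoid_morphism : monoid_morphism (@bc_fst R).
Proof.
split=> [|u v]; first by rewrite /bc_fst /= mulr0 subr0.
rewrite bc_mulE /bc_fst /=.
(* Exposing the factor -1 lets it be replaced by the square of ['i]; what remains is a polynomial
   identity in ['i]. *)
transitivity (u.1 * v.1 + (-1) * (u.2 * v.2) - 'i%C * (u.1 * v.2 + u.2 * v.1)).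
  by ring.
by rewrite -i_sqr; ring.
Qed.

Lemma bc_snd_is_monoid_morphism : monoid_morphism (@bc_snd R).
Proof.
split=> [|u v]; first by rewrite /bc_snd /= mulr0 addr0.
rewrite bc_mulE /bc_snd /=.
transitivity (u.1 * v.1 + (-1) * (u.2 * v.2) + 'i%C * (u.1 * v.2 + u.2 * v.1)).
  by ring.
by rewrite -i_sqr; ring.
Qed.

HB.instance Definition _ := GRing.isZmodMorphism.Build (bicomplex R) R[i]
  (@bc_fst R) bc_fst_is_zmod_morphism.
HB.instance Definition _ := GRing.isMonoidMorphism.Build (bicomplex R) R[i]
  (@bc_fst R) bc_fst_is_monoid_morphism.
HB.instance Definition _ := GRing.isZmodMorphism.Build (bicomplex R) R[i]
  (@bc_snd R) bc_snd_is_zmod_morphism.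
HB.instance Definition _ := GRing.isMonoidMorphism.Build (bicomplex R) R[i]
  (@bc_snd R) bc_snd_is_monoid_morphism.

(** Since [bc_cnorm] decides invertibility, this reduces it to the nonvanishing of both
    components. *)
Lemma bc_cnormE u : bc_cnorm u = bc_fst u * bc_snd u.
Proof.
transitivity (u.1 ^+ 2 - (-1) * u.2 ^+ 2); first by rewrite /bc_cnorm; ring.
by rewrite -i_sqr /bc_fst /bc_snd; ring.
Qed.

Lemma bc_unitE u : bc_fst u != 0 -> bc_snd u != 0 -> u \is a GRing.unit.
Proof.
by move=> u1 u2; change (bc_cnorm u != 0); rewrite bc_cnormE mulf_neq0.
Qed.

Lemma bc_fst_of (a : R[i]) : bc_fst (bc_of a) = a.
Proof. by rewrite /bc_fst /= mulr0 subr0. Qed.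

Lemma bc_snd_of (a : R[i]) : bc_snd (bc_of a) = a.
Proof. by rewrite /bc_snd /= mulr0 addr0. Qed.

Lemma bc_fst_j : bc_fst (bc_j R) = 1.
Proof.
rewrite rmorphM /= bc_fst_of /bc_fst /= sub0r mulr1 mulrN.
by rewrite i_sqr opprK.
Qed.

Lemma bc_snd_j : bc_snd (bc_j R) = -1.
Proof. by rewrite rmorphM /= bc_snd_of /bc_snd /= add0r mulr1 i_sqr. Qed.

Lemma bc_fst_half u : bc_fst (u / 2%:R) = bc_fst u / 2%:R.
Proof. by rewrite bc_half /bc_fst /= mulrBl mulrA. Qed.

Lemma bc_snd_half u : bc_snd (u / 2%:R) = bc_snd u / 2%:R.
Proof. by rewrite bc_half /bc_snd /= mulrDl mulrA. Qed.

Lemma bc_fst_e1 : bc_fst (bc_e1 R) = 1.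
Proof.
rewrite bc_fst_half rmorphD rmorph1 /= bc_fst_j.
by rewrite -[1 + 1]/(2%:R : R[i]) divff // pnatr_eq0.
Qed.

Lemma bc_fst_e2 : bc_fst (bc_e2 R) = 0.
Proof. by rewrite bc_fst_half rmorphB rmorph1 /= bc_fst_j subrr mul0r. Qed.

Lemma bc_snd_e1 : bc_snd (bc_e1 R) = 0.
Proof. by rewrite bc_snd_half rmorphD rmorph1 /= bc_snd_j subrr mul0r. Qed.

Lemma bc_snd_e2 : bc_snd (bc_e2 R) = 1.
Proof.
rewrite bc_snd_half rmorphB rmorph1 /= bc_snd_j opprK.
by rewrite -[1 + 1]/(2%:R : R[i]) divff // pnatr_eq0.
Qed.

Lemma bc_fst_idem (a b : R[i]) :
  bc_fst (bc_of a * bc_e1 R + bc_of b * bc_e2 R) = a.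
Proof.
rewrite rmorphD (rmorphM _ (bc_of a)) (rmorphM _ (bc_of b)) /= !bc_fst_of.
by rewrite bc_fst_e1 bc_fst_e2 mulr1 mulr0 addr0.
Qed.

Lemma bc_snd_idem (a b : R[i]) :
  bc_snd (bc_of a * bc_e1 R + bc_of b * bc_e2 R) = b.
Proof.
rewrite rmorphD (rmorphM _ (bc_of a)) (rmorphM _ (bc_of b)) /= !bc_snd_of.
by rewrite bc_snd_e1 bc_snd_e2 mulr1 mulr0 add0r.
Qed.

Lemma Re_bc_fst u : complex.Re (bc_fst u) = bc_Re u + bc_Imj u.
Proof.
rewrite /bc_fst /bc_Re /bc_Imj; case: u => [[a b] [c d]] /=.
by ring.
Qed.

Lemma Re_bc_snd u : complex.Re (bc_snd u) = bc_Re u - bc_Imj u.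
Proof.
rewrite /bc_snd /bc_Re /bc_Imj; case: u => [[a b] [c d]] /=.
by ring.
Qed.

(** The components have real parts x_0 + x_3 and x_0 - x_3, so the hypothesis puts both in the right
    half-plane. *)
Lemma Re_bc_components_gt0 u : `|bc_Imj u| < bc_Re u ->
  0 < complex.Re (bc_fst u) /\ 0 < complex.Re (bc_snd u).
Proof. by rewrite ltr_norml Re_bc_fst Re_bc_snd; lra. Qed.

(** One statement serves both components. Invertibility of the denominator is what lets [f] commute
    with the inverse, whose value at a non-unit is a default. *)
Lemma prabhakar_term_morph (f : {rmorphism bicomplex R -> R[i]})
    (s t d w : bicomplex R) (k : nat) :
  (forall u, f (bc_Gamma u) = cGamma (f u)) ->
  k`!%:R * bc_Gamma (s * k%:R + t) \is a GRing.unit ->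
  f (prabhakar_term s t d w k) =
  (\prod_(i < k) (f d + i%:R)) /
    (k`!%:R * cGamma (f s * k%:R + f t)) * f w ^+ k.
Proof.
move=> fG gU; rewrite rmorphM rmorphXn rmorphM rmorphV //= rmorphM fG.
rewrite rmorphD rmorphM !rmorph_nat /bc_poch rmorph_prod.
by under eq_bigr do rewrite rmorphD rmorph_nat.
Qed.

Lemma is_cvg_prabhakar (s t d w : bicomplex R) :
  `|bc_Imj s| < bc_Re s -> `|bc_Imj t| < bc_Re t ->
  cvgn (series (prabhakar_term s t d w)).
Proof.
move=> /Re_bc_components_gt0[s1 s2] /Re_bc_components_gt0[t1 t2].
have G1 u : bc_fst (bc_Gamma u) = cGamma (bc_fst u) by exact: bc_fst_idem.
have G2 u : bc_snd (bc_Gamma u) = cGamma (bc_snd u) by exact: bc_snd_idem.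
have Re0 (a b : R[i]) k : 0 < complex.Re a -> 0 < complex.Re b ->
    0 < complex.Re (a * k%:R + b).
  move=> a0 b0; rewrite ReD ReM_nat; apply: ltr_wpDl => //.
  by rewrite mulr_ge0 // ltW.
have gU k : k`!%:R * bc_Gamma (s * k%:R + t) \is a GRing.unit.
  have kf : (k`!%:R : R[i]) != 0 by rewrite pnatr_eq0 -lt0n fact_gt0.
  apply: bc_unitE.
    rewrite rmorphM /= G1 rmorphD rmorphM /= !rmorph_nat mulf_neq0 //.
    by apply: cGamma_neq0; exact: Re0.
  rewrite rmorphM /= G2 rmorphD rmorphM /= !rmorph_nat mulf_neq0 //.
  by apply: cGamma_neq0; exact: Re0.
have /cvg_ex[l1 c1] :=
  is_cvg_prabhakarc (bc_fst s) (bc_fst t) (bc_fst d) (bc_fst w) s1 t1.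
have /cvg_ex[l2 c2] :=
  is_cvg_prabhakarc (bc_snd s) (bc_snd t) (bc_snd d) (bc_snd w) s2 t2.
have E1 : @bc_fst R \o series (prabhakar_term s t d w) =
    series (fun k => (\prod_(i < k) (bc_fst d + i%:R)) /
      (k`!%:R * cGamma (bc_fst s * k%:R + bc_fst t)) * bc_fst w ^+ k).
  apply/funext => n; rewrite /series /= rmorph_sum; apply: eq_bigr => k _.
  exact: (prabhakar_term_morph (@bc_fst R)).
have E2 : @bc_snd R \o series (prabhakar_term s t d w) =
    series (fun k => (\prod_(i < k) (bc_snd d + i%:R)) /
      (k`!%:R * cGamma (bc_snd s * k%:R + bc_snd t)) * bc_snd w ^+ k).
  apply/funext => n; rewrite /series /= rmorph_sum; apply: eq_bigr => k _.
  exact: (prabhakar_term_morph (@bc_snd R)).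
apply/cvg_ex; exists (bc_of l1 * bc_e1 R + bc_of l2 * bc_e2 R).
apply/bc_cvgP; rewrite bc_fst_idem bc_snd_idem E1 E2.
split; [exact: c1|exact: c2].
Qed.

End Idempotent.

Theorem theorem2p1 (R : realType) (zeta vsigma tau delta : bicomplex R)
  (hvsigma : `|bc_Imj vsigma| < bc_Re vsigma)
  (htau : `|bc_Imj tau| < bc_Re tau) :
  series (fun k : nat =>
      bc_poch delta k / (k`!%:R * bc_Gamma (vsigma * k%:R + tau)) * zeta ^+ k)
    @ \oo --> prabhakar vsigma tau delta zeta.
(* [prabhakar] is the [lim] of these partial sums, so convergence to it is exactly what [cvgn]
   asserts. *)
Proof. exact: is_cvg_prabhakar. Qed.
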